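(* Let $M\in(0,\infty)$ and let $O_i=(\tilde T_i,\Delta_i)\in[0,1]\times\{0,1\}$, $i=1,\dots,n$, be right-censored data (without covariates), with ordered unique observed time points $\tilde T_{(1)}<\tilde T_{(2)}<\cdots<\tilde T_{(n')}$. Let $L^{\mathrm{pl}}(f,O)=\int_0^{\tilde T}e^{f(u)}\,du-\Delta f(\tilde T)$ for $f\in\mathcal{D}^1_M$. Let $f^\circ\in\mathcal{D}^1_M$ be given. If there exists $j\in\{1,\dots,n'-1\}$ such that $f^\circ(\tilde T_{(j)})>f^\circ(\tilde T_{(j+1)})$, then $$f^\circ\notin\arg\min_{f\in\mathcal{D}^1_M}\mathbb{P}_n[L^{\mathrm{pl}}(f,\cdot)].$$
   Context: $\mathcal{D}^1_M$ is the set of functions $f\colon[0,1]\to\mathbb{R}$ that are càdlàg (right-continuous with left limits existing at every point) and satisfy $\|f\|_v=|f(0)|+V(f)\le M$, where $V(f)=\sup\sum_{l=1}^{K}|f(x_l)-f(x_{l-1})|$ is the total variation, the supremum being over all $0=x_0<x_1<\cdots<x_K=1$. $\mathbb{P}_n[h]=\frac1n\sum_{i=1}^n h(O_i)$. Here $\tilde T=T\wedge1\wedge C$ and $\Delta=\mathbf{1}\{T\le C\wedge1\}$ for an event time $T$ and a censoring time $C$; $n'$ is the number of distinct values among $\tilde T_1,\dots,\tilde T_n$. *)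

(* Defs.v *)
From HB Require Import structures.
From mathcomp Require Import all_boot all_order all_algebra.
From mathcomp Require Import all_classical all_reals all_analysis.

Set Implicit Arguments.
Unset Strict Implicit.
Unset Printing Implicit Defensive.

Import Order.TTheory GRing.Theory Num.Theory.
Import numFieldNormedType.Exports.

Local Open Scope classical_set_scope.
Local Open Scope ring_scope.

(* A function [0,1] -> R is represented by a function on the whole line; every
   notion below depends only on its restriction to [0,1]. *)

(* Right continuity at 1 and a left limit at 0 are vacuous on [0,1]. *)
Definition cadlag01 (R : realType) (f : R -> R) : Prop :=
  (forall x, 0 <= x < 1 -> f y @[y --> x^'+] --> f x) /\
  (forall x, 0 < x <= 1 -> cvg (f y @[y --> x^'-])).

Definition vnorm (R : realType) (f : R -> R) : \bar R :=
  (`|f 0|%:E + total_variation 0 1 f)%E.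

Definition D1 (R : realType) (M : R) : set (R -> R) :=
  [set f | cadlag01 f /\ (vnorm f <= M%:E)%E].

(* An observation (t, d): follow-up time t = min(T, 1, C), and d = true iff the
   event is observed, i.e. T <= min(C, 1). *)
Definition Lpl (R : realType) (f : R -> R) (o : R * bool) : R :=
  (\int[lebesgue_measure]_(u in `[0, o.1]) expR (f u)) - o.2%:R * f o.1.

Definition empirical_mean (R : realType) (X : Type) (n : nat)
    (O : 'I_n -> X) (h : X -> R) : R :=
  n%:R^-1 * \sum_(i < n) h (O i).

Definition argmin (R : realType) (X : Type) (A : set X) (F : X -> R) : set X :=
  [set a | A a /\ forall b, A b -> F a <= F b].

Definition uniq_times (R : realType) (n : nat) (O : 'I_n -> R * bool) : seq R :=
  sort <=%O (undup [seq (O i).1 | i <- enum 'I_n]).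

Definition num_times (R : realType) (n : nat) (O : 'I_n -> R * bool) : nat :=
  size (uniq_times O).

(* The index j is 1-based; only 1 <= j <= num_times O is meaningful. *)
Definition order_time (R : realType) (n : nat) (O : 'I_n -> R * bool)
    (j : nat) : R :=
  nth 0 (uniq_times O) j.-1.

(* Main.v *)
(* Let a < b be the consecutive times with f(a) > f(b). For c slightly above a,
   f stays bounded away from f(b) just after c, so some y in [c, b] satisfies
   (b - c) e^(f(y)) < \int_c^b e^f. Replace f on [c, b[ by the constant f(y).
   The new function is f o phi with phi nondecreasing and fixing 0 and 1, so its
   total variation is no larger. No observed time lies in ]a, b[, so its values
   at the observed times are unchanged, while the integral term strictly
   decreases for every observation with time >= b. *)
Require Import Defs.
From mathcomp Require Import all_boot all_order all_algebra.
From mathcomp Require Import all_classical all_reals all_analysis.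
From mathcomp Require Import measurable_realfun zify lra.
Set Implicit Arguments.
Unset Strict Implicit.
Unset Printing Implicit Defensive.
Import Order.TTheory GRing.Theory Num.Theory.
Import numFieldNormedType.Exports.
Local Open Scope classical_set_scope.
Local Open Scope ring_scope.

(** * Total variation: monotone reparametrization, measurability, integrability *)

(** The image of a partition under [phi] may have repeated points and so need not be a partition.
    Hence an induction that peels off one point at a time, using additivity of the total variation
    of [f]. *)
Lemma total_variation_comp_nondecreasing (R : realType) (a b : R) (f phi : R -> R) :
  a <= b -> {homo phi : x y / x <= y} ->
  (total_variation a b (f \o phi) <= total_variation (phi a) (phi b) f)%E.
Proof.
move=> ab phi_nd; apply: ge_ereal_sup => _ [_ [s abs <-] <-].
elim: s a {ab} abs => [|x s ih] a abs.
  by rewrite variation_nil total_variation_ge0// phi_nd// (itv_partition_le abs).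
have [/= /andP[ax _] _] := abs.
have xbs := itv_partition_cons abs.
have xb := itv_partition_le xbs.
rewrite -cat1s (variation_cat _ (ltW ax))//; last exact: itv_partition1.
rewrite (total_variationD _ (phi_nd _ _ (ltW ax)) (phi_nd _ _ xb)) EFinD leeD ?ih//.
rewrite /variation/= big_nat1/=.
exact/total_variation_ge/phi_nd/ltW.
Qed.

(** By monotonicity the preimage of a ray is an interval, and closed rays generate the Borel
    sets. *)
Lemma nondecreasing_in_measurable (R : realType) (a b : R) (f : R -> R) :
  {in `[a, b] &, nondecreasing_fun f} -> measurable_fun `[a, b] f.
Proof.
move=> f_nd; apply: (measurability (@RGenCInfty.G R)) => //.
  exact: RGenCInfty.measurableE.
move=> /= _ [_] [r] -> <-.
apply: is_interval_measurable => s t /= [sab fs] [tab ft] u /andP[su ut].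
have uab : u \in `[a, b].
  move: sab tab; rewrite !in_itv/= => /andP[sa _] /andP[_ tb].
  by rewrite (le_trans sa su) (le_trans ut tb).
split=> //=; move: fs; rewrite /= !in_itv/= !andbT => fs.
by rewrite (le_trans fs)// f_nd.
Qed.

(** Jordan decomposition: [f] is a difference of two nondecreasing functions. The positive part is
    the negative part of [- f], so one monotonicity result serves both. *)
Lemma bounded_variation_measurable (R : realType) (a b : R) (f : R -> R) :
  bounded_variation a b f -> measurable_fun `[a, b] f.
Proof.
move=> bvf.
apply: (@eq_measurable_fun _ _ _ _ _
  ((fine \o pos_tv a f) \- (fine \o neg_tv a f))%R).
  by move=> x; rewrite inE => xab; rewrite (bounded_variation_pos_neg_tvE bvf xab).
apply: measurable_funB; apply: nondecreasing_in_measurable.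
  exact/fine_neg_tv_nondecreasing/bounded_variationN.
exact: fine_neg_tv_nondecreasing.
Qed.

(** An upper bound suffices for integrating [expR (f x)], which is bounded below by 0. *)
Lemma bounded_variation_bounded (R : realType) (a b : R) (f : R -> R) :
  bounded_variation a b f -> exists K, forall x, a <= x <= b -> f x <= K.
Proof.
have [ba|ab] := ltP b a.
  by move=> _; exists 0 => x /andP[ax /(le_trans ax)]; rewrite leNgt ba.
move=> /(bounded_variationP _ ab) bvf.
exists (f a + fine (total_variation a b f)) => x /andP[ax xb].
rewrite -lerBlDl -lee_fin fineK// (total_variationD _ ax xb).
apply: (le_trans _ (leeDl _ (total_variation_ge0 _ xb))).
by rewrite (le_trans _ (total_variation_ge _ ax))// lee_fin ler_norm.
Qed.

Lemma bounded_variation_expR_integrable (R : realType) (a b : R) (f : R -> R) :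
  bounded_variation a b f ->
  lebesgue_measure.-integrable `[a, b] (EFin \o (fun x => expR (f x))).
Proof.
move=> bvf; apply: measurable_bounded_integrable => //.
- by rewrite /= lebesgue_measure_itv/=; case: ifP => _; rewrite -?EFinB ltry.
- by apply: measurableT_comp => //; exact: bounded_variation_measurable.
have [K fK] := bounded_variation_bounded bvf.
exists (expR K); split; first exact: num_real.
move=> r Kr x /=; rewrite in_itv/= => /fK fxK.
by rewrite ger0_norm ?expR_ge0// (le_trans _ (ltW Kr))// ler_expR.
Qed.

Lemma D1_bounded_variation (R : realType) (M : R) (f : R -> R) :
  D1 M f -> bounded_variation 0 1 f.
Proof.
move=> [_ fM]; apply/bounded_variationP => //.
rewrite ge0_fin_numE ?total_variation_ge0//.
apply: le_lt_trans (ltry M); apply: le_trans fM.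
by rewrite leeDr// lee_fin.
Qed.

(** * Flattening a function on an interval by a change of argument *)

(** Acting on the argument rather than on the values makes the variation bound a matter of
    monotonicity. Openness at [b] preserves the value there, and closedness at [c] matches right
    continuity. *)
Definition collapse {R : realType} (c b y x : R) : R := if c <= x < b then y else x.

(** The jumps are from [c] up to [y] and from [y] up to [b]; both go upwards because [y] lies
    between [c] and [b]. *)
Lemma collapse_homo (R : realType) (c b y : R) : c <= y <= b ->
  {homo collapse c b y : u v / u <= v}.
Proof.
move=> /andP[cy yb] u v uv; rewrite /collapse.
case: (leP c u) => cu /=; case: (leP c v) => cv //=;
  case: (ltP u b) => ub //=; case: (ltP v b) => vb //=; lra.
Qed.

(** On a small enough one-sided neighbourhood of any point the new function agrees with [f] or with
    the constant [f y]. Strict and large inequalities in the case splits are swapped between right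
    and left limits. *)
Lemma cadlag01_collapse (R : realType) (c b y : R) (f : R -> R) :
  cadlag01 f -> cadlag01 (f \o collapse c b y).
Proof.
have cvg_eq (F : set_system R) (g h : R -> R) (l : R) : Filter F ->
    (\forall z \near F, g z = h z) -> g z @[z --> F] --> l -> h z @[z --> F] --> l.
  by move=> FF gh gl; apply: cvg_trans gl; exact: near_eq_cvg.
move=> [fr fl]; split=> x x01 /=.
  have [xc|cx] := ltP x c.
    rewrite {2}/collapse (leNgt c) xc/=; apply: cvg_eq (fr x x01).
    near=> z; rewrite /= /collapse leNgt.
    suff -> : z < c by [].
    by near: z; exact: nbhs_right_lt.
  have [xb|bx] := ltP x b.
    rewrite {2}/collapse cx xb/=; apply: cvg_eq (cvg_cst (f y)).
    near=> z; rewrite /= /collapse.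
    suff /andP[-> ->] : (c <= z) && (z < b) by [].
    apply/andP; split; last by near: z; exact: nbhs_right_lt.
    by rewrite (le_trans cx)//; near: z; exact: nbhs_right_ge.
  rewrite {2}/collapse cx ltNge bx/=; apply: cvg_eq (fr x x01).
  near=> z; rewrite /= /collapse (ltNge z).
  suff -> : b <= z by rewrite andbF.
  by rewrite (le_trans bx)//; near: z; exact: nbhs_right_ge.
have [xc|cx] := leP x c.
  apply/cvg_ex; exists (lim (f z @[z --> x^'-])); apply: cvg_eq (fl x x01).
  near=> z; rewrite /= /collapse leNgt.
  suff -> : z < c by [].
  by rewrite (lt_le_trans _ xc)//; near: z; exact: nbhs_left_lt.
have [xb|bx] := leP x b.
  apply/cvg_ex; exists (f y); apply: cvg_eq (cvg_cst (f y)).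
  near=> z; rewrite /= /collapse.
  suff /andP[-> ->] : (c <= z) && (z < b) by [].
  apply/andP; split; first by near: z; exact: nbhs_left_ge.
  by rewrite (lt_le_trans _ xb)//; near: z; exact: nbhs_left_lt.
apply/cvg_ex; exists (lim (f z @[z --> x^'-])); apply: cvg_eq (fl x x01).
near=> z; rewrite /= /collapse (ltNge z).
suff -> : b <= z by rewrite andbF.
by near: z; exact: nbhs_left_ge.
Unshelve. all: by end_near.
Qed.

(** [0 < c] and [b <= 1] make the change of argument fix 0 and 1, so the term at 0 is unchanged and
    the variation is still taken over the same interval. *)
Lemma D1_collapse (R : realType) (M c b y : R) (f : R -> R) :
  0 < c -> c <= y <= b -> b <= 1 -> D1 M f -> D1 M (f \o collapse c b y).
Proof.
move=> c0 cyb b1 [cf fM]; split; first exact: cadlag01_collapse.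
apply: le_trans fM; rewrite /vnorm.
have phi0 : collapse c b y 0 = 0 by rewrite /collapse leNgt c0.
have phi1 : collapse c b y 1 = 1 by rewrite /collapse ltNge b1 andbF.
rewrite /= phi0 leeD2l// -{2}phi0 -{2}phi1.
exact/total_variation_comp_nondecreasing/collapse_homo.
Qed.

(** * Integrals of the exponential before and after flattening *)

Lemma Rintegral_itv_cst (R : realType) (a b r : R) : a <= b ->
  \int[lebesgue_measure]_(x in `[a, b[) r = r * (b - a).
Proof.
rewrite Rintegral_cst//= lebesgue_measure_itv/= lte_fin le_eqVlt.
by case/predU1P => [->|->//]; rewrite ltxx subrr.
Qed.

Lemma Rintegral_collapse (R : realType) (c b y t : R) (f : R -> R) :
  0 <= c -> c <= y <= b -> b <= t ->
  bounded_variation 0 t f ->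
  bounded_variation 0 t (f \o collapse c b y) ->
  \int[lebesgue_measure]_(u in `[0, t]) expR (f u) -
  \int[lebesgue_measure]_(u in `[0, t]) expR ((f \o collapse c b y) u) =
  \int[lebesgue_measure]_(u in `[c, b[) expR (f u) - expR (f y) * (b - c).
Proof.
move=> c0 /andP[cy yb] bt bvf bvg.
have cb := le_trans cy yb.
have fi := bounded_variation_expR_integrable bvf.
have gi := bounded_variation_expR_integrable bvg.
have sub : `[c, b[ `<=` `[0, t].
  by move=> x /=; rewrite !in_itv/= => /andP[cx xb]; apply/andP; split; lra.
have fi' : lebesgue_measure.-integrable `[c, b[ (EFin \o (fun x => expR (f x))).
  exact: integrableS fi.
have gi' : lebesgue_measure.-integrable `[c, b[
    (EFin \o (fun x => expR ((f \o collapse c b y) x))).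
  exact: integrableS gi.
rewrite -RintegralB//.
(* The difference of the integrands vanishes off [[c, b[], so it equals its own restriction by
   zero. *)
transitivity (\int[lebesgue_measure]_(u in `[0, t])
   ((fun u => expR (f u) - expR (f (collapse c b y u))) \_ `[c, b[) u).
  apply: eq_Rintegral => x _; rewrite patchE.
  have [//|/negP xcb] := boolP (x \in _).
  rewrite /= /collapse; case: ifPn => [cxb|_]; last by rewrite subrr.
  by exfalso; apply: xcb; rewrite inE/= in_itv/=.
rewrite -Rintegral_mkcondr setIidr// RintegralB//.
congr (_ - _).
transitivity (\int[lebesgue_measure]_(u in `[c, b[) expR (f y)).
  by apply: eq_Rintegral => x; rewrite inE/= in_itv/= => cxb; rewrite /collapse cxb.
exact: Rintegral_itv_cst.
Qed.

(** Otherwise [expR (f y)] is at least its mean [K] for every [y] in [[c, b]]; at [b] this gives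
    [K < expR m]. The integrand is then at least [expR m] on [[c, d[], of positive length, and at
    least [K] on [[d, b[], so its mean exceeds [K]. *)
Lemma lt_Rintegral_average (R : realType) (c d b m : R) (f : R -> R) :
  c < d <= b -> bounded_variation c b f ->
  (forall x, c <= x < d -> m <= f x) -> f b < m ->
  exists2 y, c <= y <= b &
  expR (f y) * (b - c) < \int[lebesgue_measure]_(u in `[c, b[) expR (f u).
Proof.
move=> /andP[cd db] bvf mf fbm; apply/not_exists2P => H.
set I := Rintegral _ _ _ in H.
have {}H y : c <= y <= b -> I / (b - c) <= expR (f y).
  move=> cyb; have [/(_ cyb)//|/negP] := H y.
  by rewrite -leNgt -ler_pdivrMr//; lra.
set K := I / (b - c) in H.
have Km : K < expR m.
  by apply: le_lt_trans (H b _) _; [lra|rewrite ltr_expR].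
have fi := bounded_variation_expR_integrable bvf.
have itv_cst (u v r : R) : u <= v ->
   lebesgue_measure.-integrable `[u, v[ (EFin \o cst r) /\
   \int[lebesgue_measure]_(x in `[u, v[) r = r * (v - u).
  move=> uv; split; last exact: Rintegral_itv_cst.
  apply: measurable_bounded_integrable => //.
    by rewrite /= lebesgue_measure_itv/=; case: ifP => _; rewrite -?EFinB ltry.
  by exists `|r|; split=> // z rz x _ /=; exact: ltW.
have fi1 : lebesgue_measure.-integrable `[c, d[ (EFin \o (fun x => expR (f x))).
  by apply: integrableS fi => //= x /=; rewrite !in_itv/=; lra.
have fi2 : lebesgue_measure.-integrable `[d, b[ (EFin \o (fun x => expR (f x))).
  by apply: integrableS fi => //= x /=; rewrite !in_itv/=; lra.
have fi3 : lebesgue_measure.-integrable `[c, b[ (EFin \o (fun x => expR (f x))).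
  by apply: integrableS fi => //= x /=; rewrite !in_itv/=; lra.
have cdb : `[c, b[%classic = `[c, d[ `|` `[d, b[.
  by rewrite -itv_bndbnd_setU// bnd_simp ltW.
have IE : I = \int[lebesgue_measure]_(u in `[c, d[) expR (f u) +
              \int[lebesgue_measure]_(u in `[d, b[) expR (f u).
  rewrite /I cdb Rintegral_setU//; first by rewrite -cdb.
  by apply/disj_setPS => x /= []; rewrite !in_itv/=; lra.
have I1 : expR m * (d - c) <= \int[lebesgue_measure]_(u in `[c, d[) expR (f u).
  have [ci <-] := itv_cst c d (expR m) (ltW cd).
  by apply: le_Rintegral => // x /=; rewrite in_itv/= => /mf; rewrite ler_expR.
have I2 : K * (b - d) <= \int[lebesgue_measure]_(u in `[d, b[) expR (f u).
  have [ci <-] := itv_cst d b K db.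
  by apply: le_Rintegral => // x /=; rewrite in_itv/= => xdb; apply: H; lra.
have IK : I = K * (b - c) by rewrite /K divfK//; lra.
have : 0 < (expR m - K) * (d - c) by rewrite mulr_gt0//; lra.
by nra.
Qed.

Lemma right_continuous_gt (R : realType) (a b m : R) (f : R -> R) :
  a < b -> f y @[y --> a^'+] --> f a -> m < f a ->
  exists c, exists d, [/\ a < c, c < d, d <= b & forall x, c <= x < d -> m <= f x].
Proof.
move=> ab fa mfa.
have /nbhs_ballP[e /= e0 ae] : \forall y \near a^'+, m < f y by exact: cvgr_gt fa _ _.
pose r := Num.min e (b - a).
have r0 : 0 < r by rewrite lt_min e0 subr_gt0.
have re : r <= e by rewrite ge_min lexx.
have rb : r <= b - a by rewrite ge_min lexx orbT.
(* Starting at the midpoint and not at [a] keeps the value at [a], and makes [c] positive even when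
   [a] is 0. *)
exists (a + r / 2), (a + r); split; [lra|lra|lra|] => x /andP[cx xr].
by apply/ltW/ae; [rewrite /ball/= distrC ger0_norm; lra|lra].
Qed.

(** * Ordered distinct observed times *)

Lemma order_time_lt (R : realType) (n : nat) (O : 'I_n -> R * bool) (j : nat) :
  (1 <= j <= (num_times O).-1)%N -> order_time O j < order_time O j.+1.
Proof.
rewrite /num_times /order_time => /andP[j0 jn].
(* The 1-based times [j] and [j.+1] sit at list indices [j.-1] and [j]; both are in range, so the
   default 0 of [nth] is never read. *)
have j1 : (j.-1 < size (uniq_times O))%N by lia.
have j2 : (j < size (uniq_times O))%N by lia.
apply: (sorted_ltn_nth lt_trans) => //; last by rewrite prednK.
by rewrite /uniq_times sort_lt_sorted undup_uniq.
Qed.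

Lemma order_time_mem (R : realType) (n : nat) (O : 'I_n -> R * bool) (j : nat) :
  (1 <= j <= num_times O)%N -> exists i, (O i).1 = order_time O j.
Proof.
move=> /andP[j0 jn].
have : order_time O j \in uniq_times O by rewrite mem_nth// prednK.
by rewrite mem_sort mem_undup => /mapP[i _ ->]; exists i.
Qed.

Lemma order_time_consecutive (R : realType) (n : nat) (O : 'I_n -> R * bool)
    (j : nat) (i : 'I_n) : (1 <= j <= (num_times O).-1)%N ->
  (O i).1 <= order_time O j \/ order_time O j.+1 <= (O i).1.
Proof.
rewrite /order_time /num_times => /andP[j0 jn].
have : (O i).1 \in uniq_times O.
  by rewrite mem_sort mem_undup; apply/mapP; exists i; rewrite ?mem_enum.
move=> /(nthP 0)[k ks <-].
have j1 : (j.-1 < size (uniq_times O))%N by lia.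
have j2 : (j < size (uniq_times O))%N by lia.
have le_nth i1 i2 : (i1 <= i2)%N -> (i1 < size (uniq_times O))%N ->
    (i2 < size (uniq_times O))%N ->
    nth 0 (uniq_times O) i1 <= nth 0 (uniq_times O) i2.
  move=> i12 si1 si2; apply: (sorted_leq_nth le_trans le_refl) => //.
  exact: sort_le_sorted.
(* No index lies strictly between [j.-1] and [j]. *)
by case: (leqP k j.-1) => kj; [left|right]; apply: le_nth => //; lia.
Qed.

Theorem proposition10 (R : realType) (M : R) (hM : 0 < M)
    (n : nat) (O : 'I_n -> R * bool) (hO : forall i, 0 <= (O i).1 <= 1)
    (f0 : R -> R) (hf0 : D1 M f0)
    (hj : exists j : nat, (1 <= j <= (num_times O).-1)%N /\
            f0 (order_time O j) > f0 (order_time O j.+1)) :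
  ~ argmin (D1 M) (fun f => empirical_mean O (Lpl f)) f0.
Proof.
case: hj => j [jn]; set a := order_time O j; set b := order_time O j.+1 => fba.
have ab : a < b by exact: order_time_lt.
have [ia iaE] : exists i, (O i).1 = a by apply: order_time_mem; lia.
have [ib ibE] : exists i, (O i).1 = b by apply: order_time_mem; lia.
have a0 : 0 <= a by have := hO ia; rewrite iaE => /andP[].
have b1 : b <= 1 by have := hO ib; rewrite ibE => /andP[].
(* The index [ia] witnesses a nonempty sample, so the factor [n%:R^-1] is positive and can be
   cancelled. *)
have n0 : (0 < n)%N by case: n ia {O hO jn a b fba ab iaE ib ibE a0 b1} => // -[].
(* Any level strictly between would do: below [f0 a] for right continuity, above [f0 b] for the
   averaging argument. *)
pose m := (f0 a + f0 b) / 2.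
have [[fr _] _] := hf0.
have [||c [d [ac cd db mf]]] := @right_continuous_gt _ a b m f0 ab.
- by apply: fr; lra.
- by rewrite /m; lra.
have bvf := D1_bounded_variation hf0.
have [||||y cyb ylt] := @lt_Rintegral_average _ c d b m f0.
- by rewrite cd db.
- by apply: (bounded_variationl _ b1); [lra|apply: bounded_variationr bvf; lra].
- exact: mf.
- by rewrite /m; lra.
pose f1 := f0 \o collapse c b y.
have D1f1 : D1 M f1 by apply: D1_collapse; rewrite //; lra.
have bvf1 := D1_bounded_variation D1f1.
move=> [_ /(_ f1 D1f1)]; apply/negP; rewrite -ltNge /empirical_mean.
rewrite ltr_pM2l ?invr_gt0 ?ltr0n//.
have f1_out t : t < c \/ b <= t -> f1 t = f0 t.
  by rewrite /f1 /= /collapse => -[tc|bt];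
    [rewrite (leNgt c) tc|rewrite ltNge bt andbF].
(* The event term is unchanged at times from [b] on, and the integral covers all of [[c, b[]. *)
have lt_b i : b <= (O i).1 -> Lpl f1 (O i) < Lpl f0 (O i).
  move=> bi; have /andP[ti0 ti1] := hO i.
  rewrite /Lpl f1_out ?ltrD2r; last by right.
  rewrite -subr_gt0 Rintegral_collapse ?subr_gt0//; first lra.
  - exact: bounded_variationl bvf.
  - exact: bounded_variationl bvf1.
(* A time before [b] is at most [a], hence below [c]; there the two losses coincide. *)
have le_i i : Lpl f1 (O i) <= Lpl f0 (O i).
  have [ti|/lt_b/ltW//] := order_time_consecutive i jn.
  have tc : (O i).1 < c by rewrite (le_lt_trans ti).
  rewrite /Lpl f1_out ?lerD2r; last by left.
  rewrite le_eqVlt; apply/orP; left; apply/eqP/eq_Rintegral => x.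
  by rewrite inE/= in_itv/= => /andP[_ xt]; rewrite f1_out//; left; lra.
(* The observation [ib], made exactly at time [b], supplies the strict inequality in the sum. *)
rewrite (bigD1 ib)//= [ltRHS](bigD1 ib)//= ltr_leD//; last exact: ler_sum.
by apply: lt_b; rewrite ibE.
Qed.
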